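(* Let $c>0$, $d>0$ and $m>0$ be real numbers, and consider the equation $$m x=\left(\frac{1+cd\,x}{d+c\,x}\right)^3 \qquad (x\ge 0).$$ (i) If $d<1$, then the equation has exactly one solution $x\ge 0$. (ii) If $d>2$, then, setting $$\eta_1(c,d)=-\frac{c d^4\left(1-d^2+\sqrt{4-5d^2+d^4}\right)^3}{\left(2-2d^2+\sqrt{4-5d^2+d^4}\right)^3\left(2-d^2+\sqrt{4-5d^2+d^4}\right)},$$ $$\eta_2(c,d)=\frac{c d^4\left(-1+d^2+\sqrt{4-5d^2+d^4}\right)^3}{\left(-2+d^2+\sqrt{4-5d^2+d^4}\right)\left(-2+2d^2+\sqrt{4-5d^2+d^4}\right)^3},$$ one has $0<\eta_1(c,d)<\eta_2(c,d)$, and the equation has exactly 3 solutions $x\ge 0$ if $\eta_1(c,d)<m<\eta_2(c,d)$, and exactly 2 solutions $x\ge 0$ if either $m=\eta_1(c,d)$ or $m=\eta_2(c,d)$.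
   Context: All quantities are real. Solutions are counted as distinct real numbers $x\ge 0$ (without multiplicity). *)

(* Defs.v *)
From mathcomp Require Import all_boot all_order all_algebra.
From mathcomp Require Import all_classical all_reals.
Set Implicit Arguments.
Unset Strict Implicit.
Unset Printing Implicit Defensive.
Import Order.TTheory GRing.Theory Num.Theory.
Local Open Scope classical_set_scope.
Local Open Scope ring_scope.

(* Where [d + c * x = 0] MathComp's total division would return 0; this does
   not occur for [c, d > 0] and [x >= 0]. *)
Definition solutions (R : realType) (c d m : R) : set R :=
  [set x | 0 <= x /\ m * x = ((1 + c * d * x) / (d + c * x)) ^+ 3].

(* For [d > 2] the radicand [(d ^+ 2 - 1) * (d ^+ 2 - 4)] is positive and the
   denominators below are nonzero. *)
Definition eta_root (R : realType) (d : R) : R :=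
  Num.sqrt (4 - 5 * d ^+ 2 + d ^+ 4).

Definition eta1 (R : realType) (c d : R) : R :=
  - ((c * d ^+ 4 * (1 - d ^+ 2 + eta_root d) ^+ 3)
     / ((2 - 2 * d ^+ 2 + eta_root d) ^+ 3 * (2 - d ^+ 2 + eta_root d))).

Definition eta2 (R : realType) (c d : R) : R :=
  (c * d ^+ 4 * (- 1 + d ^+ 2 + eta_root d) ^+ 3)
  / ((- 2 + d ^+ 2 + eta_root d) * (- 2 + 2 * d ^+ 2 + eta_root d) ^+ 3).

(* Main.v *)
Require Import Defs.
From mathcomp Require Import all_boot all_order all_algebra.
From mathcomp Require Import all_classical all_reals.
From mathcomp Require Import polyrcf ring lra.
Import Order.TTheory GRing.Theory Num.Theory.
Local Open Scope classical_set_scope.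
Local Open Scope card_scope.
Local Open Scope ring_scope.

(** After the substitution [u = c x] and with [M = m / c], the solutions are the
    nonnegative roots of the quartic [G = M u (d + u)^3 - (1 + d u)^3], whose
    sign at [u > 0] is that of [M - F u], where
    [F u = (1 + d u)^3 / (u (d + u)^3)].
    For [d < 1], [F] is decreasing, whence uniqueness.  For [d > 2], [eta1 / c]
    and [eta2 / c] are the values of [F] at its critical points [a < b], which
    are the roots of [d u^2 - (2 d^2 - 4) u + d].  Since [G (-d) > 0 > G 0], one
    root is negative; sign changes at [a] and [b] produce the other three, or
    one of them next to a double root at [a] or [b], and the degree of [G] leaves
    no room for more. *)

(** * Finite cardinality and the number of roots of a polynomial *)

Lemma card_set_uniq {T : eqType} (s : seq T) :
  uniq s -> [set` s] #= `I_(size s).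
Proof.
elim: s => [_|x s IHs /= /andP[xs us]]; first by rewrite set_nil II0 card_eq0.
apply/eq_cardSP; exists x; first by rewrite /= mem_head.
suff -> : [set` x :: s] `\ x = [set` s] by exact: IHs.
apply/seteqP; split=> y /=; rewrite inE.
  by case=> /orP[/eqP-> []|].
by move=> ys; split; [rewrite ys orbT | move=> yx; rewrite -yx ys in xs].
Qed.

(** A double root counts twice: writing [p = q * ('X - a)], the derivative takes the value [q.[a]]
    at [a], so [a] is again a root of [q], and the usual bound applies to [q] with [a :: rs]. *)
Lemma max_poly_roots_double {F : fieldType} (p : {poly F}) (a : F) (rs : seq F) :
  p != 0 -> root p^`() a -> all (root p) (a :: rs) -> uniq (a :: rs) ->
  ((size rs).+2 < size p)%N.
Proof.
move=> p0 dpa /= /andP[pa prs] /andP[ars urs].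
have /factor_theorem[q pE] := pa.
have q0 : q != 0 by apply: contraNneq p0 => q0; rewrite pE q0 mul0r.
have qa : root q a.
  move: dpa; rewrite pE derivM derivXsubC /root !hornerE subrr mulr0 add0r.
  by rewrite ?mulr1.
have qrs : all (root q) rs.
  apply/allP => x xrs; have := allP prs _ xrs.
  rewrite pE rootM root_XsubC => /orP[//|/eqP xa].
  by rewrite -xa xrs in ars.
have := @max_poly_roots _ q (a :: rs) q0; rewrite /= qa qrs ars urs.
by move=> /(_ isT isT); rewrite pE size_Mmonic ?monicXsubC// size_XsubC addn2.
Qed.

(** * The quartic and the location of its roots *)

Definition quartic {R : realType} (d M : R) : {poly R} :=
  Poly [:: -1; M * d ^+ 3 - 3 * d; 3 * M * d ^+ 2 - 3 * d ^+ 2;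
           3 * M * d - d ^+ 3; M].

Lemma horner_quartic {R : realType} (d M u : R) :
  (quartic d M).[u] = M * u * (d + u) ^+ 3 - (1 + d * u) ^+ 3.
Proof. by rewrite horner_Poly /=; ring. Qed.

Lemma horner_deriv_quartic {R : realType} (d M u : R) :
  (quartic d M)^`().[u] =
  M * ((d + u) ^+ 3 + 3 * u * (d + u) ^+ 2) - 3 * d * (1 + d * u) ^+ 2.
Proof.
by rewrite /quartic /= !cons_poly_def !derivE !(hornerD, hornerM, hornerC, hornerX); ring.
Qed.

Lemma size_quartic {R : realType} (d M : R) : (size (quartic d M) <= 5)%N.
Proof. exact: size_Poly. Qed.

Lemma horner_quartic0 {R : realType} (d M : R) : (quartic d M).[0] = -1.
Proof. by rewrite horner_quartic; ring. Qed.

Lemma quartic_neq0 {R : realType} (d M : R) : quartic d M != 0.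
Proof.
apply/eqP => q0; have := horner_quartic0 d M.
by rewrite q0 horner0; lra.
Qed.

(** With [K = d + 1/d], one has [1 + d B <= K (d + B)] for [B >= 0], so the cube on the left is at
    most [K^3 (d + B)^3]. The choice of [B] makes [M B] exceed [K^3], and the positive term wins. *)
Lemma quartic_eventually_gt0 {R : realType} (d M t : R) : 0 < d -> 0 < M -> 0 < t ->
  exists2 B, t < B & 0 < (quartic d M).[B].
Proof.
move=> d0 M0 t0; pose K := d + d^-1.
have K0 : 0 < K by rewrite addr_gt0 // invr_gt0.
have KM : 0 < K ^+ 3 / M by rewrite divr_gt0 // exprn_gt0.
exists (t + K ^+ 3 / M); first by rewrite ltrDl.
set B := t + _; have B0 : 0 < B by rewrite addr_gt0.
have MB : K ^+ 3 < M * B.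
  by rewrite /B mulrDr mulrCA mulfV ?lt0r_neq0 // mulr1 ltrDr mulr_gt0.
have KB : 1 + d * B <= K * (d + B).
  have -> : K * (d + B) = 1 + d * B + d ^+ 2 + B / d.
    by rewrite /K; field; exact: lt0r_neq0.
  by rewrite -addrA lerDl addr_ge0 ?sqr_ge0 // divr_ge0 // ltW.
rewrite horner_quartic subr_gt0.
apply: (@le_lt_trans _ _ ((K * (d + B)) ^+ 3)).
  by rewrite lerXn2r // nnegrE; nra.
by rewrite exprMn ltr_pM2r // exprn_gt0 // addr_gt0.
Qed.

Lemma quartic_root_gt {R : realType} (d M t : R) : 0 < d -> 0 < M -> 0 < t -> (quartic d M).[t] < 0 ->
  exists2 u, t < u & root (quartic d M) u.
Proof.
move=> d0 M0 t0 qt.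
have [B tB qB] := @quartic_eventually_gt0 R d M t d0 M0 t0.
have [|u] := @poly_ivtoo _ (quartic d M) t B (ltW tB).
  by rewrite nmulr_rlt0.
by rewrite in_itv /= => /andP[tu _] ru; exists u.
Qed.

Lemma quartic_root_lt0 {R : realType} (d M : R) :
  1 < d -> exists2 u, u < 0 & root (quartic d M) u.
Proof.
move=> d1; have [||u] := @poly_ivtoo _ (quartic d M) (- d) 0.
- by lra.
- have -> : (quartic d M).[- d] = (d ^+ 2 - 1) ^+ 3 by rewrite horner_quartic; ring.
  by rewrite horner_quartic0 mulrN1 oppr_lt0 exprn_gt0 // subr_gt0 exprn_egt1.
by rewrite in_itv /= => /andP[_ u0] ru; exists u.
Qed.

(** This is the strict decrease of [F] for [d < 1], with denominators cleared. Eliminating [M]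
    between two roots gives [v P^3 = u Q^3], which is impossible because
    [P - Q = (1 - d^2) (v - u) > 0] and [v > u]. *)
Lemma quartic_root_uniq {R : realType} (d M u v : R) :
  0 < d -> d < 1 -> 0 < M -> 0 < u -> u < v ->
  root (quartic d M) u -> (quartic d M).[v] != 0.
Proof.
move=> d0 d1 M0 u0 uv /eqP; rewrite !horner_quartic => /eqP.
rewrite subr_eq0 => /eqP qu; rewrite subr_eq0; apply/eqP => qv.
have v0 : 0 < v by exact: lt_trans uv.
pose P := (1 + d * u) * (d + v); pose Q := (1 + d * v) * (d + u).
have Q0 : 0 < Q by rewrite mulr_gt0 ?addr_gt0 ?mulr_gt0.
have QP : Q < P.
  rewrite -subr_gt0 (_ : P - Q = (1 - d) * ((1 + d) * (v - u))).
    by rewrite !mulr_gt0 ?subr_gt0 ?addr_gt0.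
  by rewrite /P /Q; ring.
have : v * P ^+ 3 = u * Q ^+ 3 by rewrite !exprMn -qu -qv; ring.
apply/eqP; rewrite gt_eqF // ltr_pM ?exprn_ge0 ?(ltW u0) ?(ltW Q0) //.
by rewrite ltrXn2r // ?nnegrE ltW // (lt_trans Q0).
Qed.

(** * Counting solutions through the nonnegative roots *)

Lemma card_solutions {R : realType} (c d m : R) (s : seq R) :
  0 < c -> 0 < d -> uniq s ->
  (forall u, u \in s <-> 0 <= u /\ root (quartic d (m / c)) u) ->
  solutions c d m #= `I_(size s).
Proof.
move=> c0 d0 us sP.
have cn0 : c != 0 by rewrite lt0r_neq0.
have solE x : 0 <= x ->
    (m * x = ((1 + c * d * x) / (d + c * x)) ^+ 3) <-> root (quartic d (m / c)) (c * x).
  move=> x0; have dcx0 : d + c * x != 0.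
    by rewrite lt0r_neq0 // ltr_wpDr // mulr_ge0 // ltW.
  rewrite /root horner_quartic subr_eq0 expr_div_n.
  have -> : m / c * (c * x) = m * x by field.
  have -> : 1 + d * (c * x) = 1 + c * d * x by ring.
  split=> [->|/eqP <-]; first by rewrite divfK // expf_neq0.
  by rewrite mulfK // expf_neq0.
(* Undoing the substitution [u = c x] is injective, so no root is lost in the count. *)
suff -> : solutions c d m = [set` [seq u / c | u <- s]].
  rewrite -(size_map (fun u => u / c) s); apply: card_set_uniq.
  by rewrite map_inj_uniq // => x y /(mulIf _); apply; rewrite invr_neq0.
apply/seteqP; split => x /=.
  case=> x0 /(solE _ x0) rx; apply/mapP; exists (c * x); last by field.
  by apply/sP; rewrite mulr_ge0 // ltW.
case/mapP => u /sP[u0 ru] ->.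
have uc0 : 0 <= u / c by rewrite divr_ge0 // ltW.
by split=> //; apply/solE => //; rewrite mulrCA mulfV // mulr1.
Qed.

Lemma card_solutions_lt1 {R : realType} (c d m : R) :
  0 < c -> 0 < d -> d < 1 -> 0 < m -> solutions c d m #= `I_1.
Proof.
move=> c0 d0 d1 m0; have M0 : 0 < m / c by exact: divr_gt0.
have root_gt0 u : 0 <= u -> root (quartic d (m / c)) u -> 0 < u.
  rewrite le_eqVlt => /predU1P[<-|//].
  by rewrite /root horner_quartic0 oppr_eq0 oner_eq0.
(* The threshold 1 is arbitrary: it only ensures that [B] is positive. *)
have [B B0 qB] := quartic_eventually_gt0 d (m / c) 1 d0 M0 ltr01.
have [||u] := @poly_ivtoo _ (quartic d (m / c)) 0 B.
- by rewrite (le_trans ler01) // ltW.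
- by rewrite horner_quartic0 mulN1r oppr_lt0.
rewrite in_itv /= => /andP[u0 _] ru.
apply: (card_solutions c d m [:: u]) => // v; rewrite inE; split.
  by move=> /eqP->; rewrite ltW.
move=> [v0 rv]; have {}v0 := root_gt0 _ v0 rv.
apply/eqP; case: (ltgtP v u) => // vu.
  by have := quartic_root_uniq d (m / c) v u d0 d1 M0 v0 vu rv; rewrite -/(root _ _) ru.
by have := quartic_root_uniq d (m / c) u v d0 d1 M0 u0 vu ru; rewrite -/(root _ _) rv.
Qed.

Lemma card_solutions_three {R : realType} (c d m a b : R) :
  0 < c -> 1 < d -> 0 < m -> 0 < a -> a < b ->
  0 < (quartic d (m / c)).[a] -> (quartic d (m / c)).[b] < 0 ->
  solutions c d m #= `I_3.
Proof.
move=> c0 d1 m0 a0 ab; set q := quartic d (m / c) => qa qb.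
have d0 : 0 < d by exact: lt_trans d1.
have M0 : 0 < m / c by exact: divr_gt0.
have [n n0 rn] : exists2 u, u < 0 & root q u by exact: quartic_root_lt0.
have [|r] := @poly_ivtoo _ q 0 a (ltW a0).
  by rewrite horner_quartic0 mulN1r oppr_lt0.
rewrite in_itv /= => /andP[r0 ra] rr.
have [|s] := @poly_ivtoo _ q a b (ltW ab); first by rewrite pmulr_rlt0.
rewrite in_itv /= => /andP[sa sb] rs.
have [t tb rt] := quartic_root_gt d (m / c) b d0 M0 (lt_trans a0 ab) qb.
have rsn : r < s by exact: lt_trans sa.
have stn : s < t by exact: lt_trans tb.
have urst : uniq [:: r; s; t].
  by rewrite /= !inE !negb_or !lt_eqF // (lt_trans rsn).
apply: (card_solutions c d m [:: r; s; t]) => // u; split.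
  by rewrite !inE => /or3P[] /eqP->; split; rewrite // ltW // ?(lt_trans r0) // (lt_trans rsn).
move=> [u0 ru]; apply/negPn/negP => urstP.
(* A further nonnegative root [u] would give five distinct roots, hence size at least 6, against
   size at most 5. *)
have := max_poly_roots (rs := [:: u, n & [:: r; s; t]]) (quartic_neq0 d (m / c)).
rewrite [all _ _]/= ru rn rr rs rt => /(_ isT).
suff unq : uniq [:: u, n & [:: r; s; t]].
  by move=> /(_ unq); apply/negP; rewrite -leqNgt size_quartic.
rewrite cons_uniq inE negb_or urstP gt_eqF ?(lt_le_trans n0) //.
rewrite cons_uniq urst !inE !negb_or !lt_eqF // ?(lt_trans n0) //.
  by rewrite (lt_trans r0) // (lt_trans rsn).
by rewrite (lt_trans r0).
Qed.

(** The order of [a] and [r] is left open, so that the double root may be the smaller solution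
    ([m = eta1]) or the larger one ([m = eta2]). *)
Lemma card_solutions_double {R : realType} (c d m a r : R) :
  0 < c -> 1 < d -> 0 < m -> 0 < a -> 0 < r -> a != r ->
  root (quartic d (m / c)) r -> root (quartic d (m / c)) a ->
  root (quartic d (m / c))^`() a -> solutions c d m #= `I_2.
Proof.
move=> c0 d1 m0 a0 r0 ar rr ra rda.
have d0 : 0 < d by exact: lt_trans d1.
have M0 : 0 < m / c by exact: divr_gt0.
have [n n0 rn] := quartic_root_lt0 d (m / c) d1.
apply: (card_solutions c d m [:: a; r]) => //; first by rewrite /= inE ar.
move=> u; split.
  by rewrite !inE => /orP[] /eqP->; split; rewrite // ltW.
move=> [u0 ru]; apply/negPn/negP => uar.
have := max_poly_roots_double (quartic d (m / c)) a [:: u; n; r] (quartic_neq0 _ _) rda.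
rewrite [all _ _]/= ru rn rr ra => /(_ isT).
suff unq : uniq [:: a; u; n; r].
  by move=> /(_ unq); apply/negP; rewrite -leqNgt size_quartic.
move: uar; rewrite !inE negb_or => /andP[ua ur].
rewrite /= !inE !negb_or ar ur eq_sym ua (gt_eqF (lt_trans n0 a0)).
by rewrite (gt_eqF (lt_le_trans n0 u0)) (lt_eqF (lt_trans n0 r0)).
Qed.

(** * Critical points of [F] and the two thresholds *)

Definition ratio {R : realType} (d u : R) : R := (1 + d * u) ^+ 3 / (u * (d + u) ^+ 3).

Lemma horner_quartic_ratio {R : realType} (d M u : R) : 0 < d -> 0 < u ->
  (quartic d M).[u] = u * (d + u) ^+ 3 * (M - ratio d u).
Proof.
move=> d0 u0; rewrite horner_quartic /ratio; field.
by rewrite !lt0r_neq0 // addr_gt0.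
Qed.

Lemma ratio_gt0 {R : realType} (d u : R) : 0 < d -> 0 < u -> 0 < ratio d u.
Proof. by move=> d0 u0; rewrite divr_gt0 ?mulr_gt0 ?exprn_gt0 ?addr_gt0 ?mulr_gt0. Qed.

(** For [u > 0], this quadratic is the numerator of [F'], up to a factor of constant negative
    sign. *)
Definition critical {R : realType} (d u : R) : Prop :=
  d * u ^+ 2 - (2 * d ^+ 2 - 4) * u + d = 0.

(** Since [G = u (d + u)^3 (M - F u)], taking [M] to be a critical value of [F] makes the derivative
    vanish together with [G]. *)
Lemma critical_root_deriv {R : realType} (d u : R) : 0 < d -> 0 < u -> critical d u ->
  root (quartic d (ratio d u))^`() u.
Proof.
move=> d0 u0 cu; rewrite /root horner_deriv_quartic.
have -> : ratio d u * ((d + u) ^+ 3 + 3 * u * (d + u) ^+ 2) - 3 * d * (1 + d * u) ^+ 2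
    = (1 + d * u) ^+ 2 / (u * (d + u)) * (d * u ^+ 2 - (2 * d ^+ 2 - 4) * u + d).
  by rewrite /ratio; field; rewrite !lt0r_neq0 // addr_gt0.
by rewrite cu mulr0.
Qed.

(** Reducing [F u - 1] modulo the critical quadratic isolates the factor [u^2 - 1]. For [d > 2] the
    other factor is positive, so critical values lie below or above 1 according to the position of
    [u] relative to 1. *)
Lemma critical_ratioB1 {R : realType} (d u : R) : 0 < d -> 0 < u -> critical d u ->
  ratio d u - 1 =
  (u ^+ 2 - 1) * ((d ^+ 2 - 1) * (d ^+ 2 - 4) / (d * (d + u) ^+ 3)).
Proof.
move=> d0 u0 cu.
apply/eqP; rewrite -subr_eq0.
have -> : ratio d u - 1 - (u ^+ 2 - 1) * ((d ^+ 2 - 1) * (d ^+ 2 - 4) / (d * (d + u) ^+ 3))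
  = (1 - u ^+ 2) / (d * u * (d + u) ^+ 3) * (d * u ^+ 2 - (2 * d ^+ 2 - 4) * u + d).
  by rewrite /ratio; field; rewrite !lt0r_neq0 // addr_gt0.
by rewrite cu mulr0.
Qed.

Lemma critical_ratio_lt {R : realType} (d a b : R) :
  2 < d -> 0 < a -> a < 1 -> 1 < b -> critical d a -> critical d b ->
  ratio d a < ratio d b.
Proof.
move=> d2 a0 a1 b1 ca cb.
have d0 : 0 < d by lra.
have b0 : 0 < b by lra.
have K0 u : 0 < u -> 0 < (d ^+ 2 - 1) * (d ^+ 2 - 4) / (d * (d + u) ^+ 3).
  move=> u0; apply: divr_gt0; last by rewrite mulr_gt0 ?exprn_gt0 ?addr_gt0.
  by apply: mulr_gt0; rewrite expr2; nra.
apply: (@lt_trans _ _ 1).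
  by rewrite -subr_lt0 critical_ratioB1 // nmulr_rlt0 ?K0 // subr_lt0 expr_lt1 // ltW.
by rewrite -subr_gt0 critical_ratioB1 // mulr_gt0 ?K0 // subr_gt0 exprn_egt1.
Qed.

Lemma eta_critical {R : realType} (c d : R) : 2 < d ->
  exists a b, [/\ 0 < a < 1, 1 < b, critical d a, critical d b &
    eta1 c d = c * ratio d a /\ eta2 c d = c * ratio d b].
Proof.
move=> d2; have d0 : 0 < d by lra.
have dn0 := lt0r_neq0 d0.
have d4 : 4 < d ^+ 2 by rewrite expr2; nra.
have rad : 4 - 5 * d ^+ 2 + d ^+ 4 = (d ^+ 2 - 1) * (d ^+ 2 - 4) by ring.
rewrite /eta1 /eta2; set s := eta_root d.
have s2 : s ^+ 2 = 4 - 5 * d ^+ 2 + d ^+ 4.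
  by rewrite sqr_sqrtr // rad mulr_ge0 // expr2; nra.
have s0 : 0 < s by rewrite sqrtr_gt0 rad mulr_gt0 // expr2; nra.
have sd : s < d ^+ 2 - 2.
  by rewrite -(@ltr_pXn2r _ 2) ?nnegrE ?s2 ?(ltW s0) //; nra.
(* The quadratic formula, for both signs [e = s] and [e = - s] at once. *)
have crit e : e ^+ 2 = s ^+ 2 -> critical d ((d ^+ 2 - 2 + e) / d).
  move=> e2; rewrite /critical.
  have -> : d * ((d ^+ 2 - 2 + e) / d) ^+ 2
      - (2 * d ^+ 2 - 4) * ((d ^+ 2 - 2 + e) / d) + d
    = (e ^+ 2 - (4 - 5 * d ^+ 2 + d ^+ 4)) / d by field.
  by rewrite e2 s2 subrr mul0r.
have ab1 : (d ^+ 2 - 2 - s) / d * ((d ^+ 2 - 2 + s) / d) = 1.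
  have -> : (d ^+ 2 - 2 - s) / d * ((d ^+ 2 - 2 + s) / d)
    = ((d ^+ 2 - 2) ^+ 2 - s ^+ 2) / d ^+ 2 by field.
  by rewrite s2; field.
have b1 : 1 < (d ^+ 2 - 2 + s) / d by rewrite ltr_pdivlMr // mul1r; nra.
have a0 : 0 < (d ^+ 2 - 2 - s) / d by rewrite divr_gt0 // subr_gt0.
exists ((d ^+ 2 - 2 - s) / d), ((d ^+ 2 - 2 + s) / d); split=> //.
(* The product of the two roots is 1, so [b > 1] forces [a < 1]. *)
- by rewrite a0 -[ltRHS]ab1 ltr_pMr.
- by apply: crit; rewrite sqrrN.
- exact: crit.
split.
(* Here [1 + d a], [d (d + a)] and [d a] are the opposites of the three expressions in [s] in
   [eta1], and the powers of [d] account for [d^4]. For [eta2] the same holds with [b] and no change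
   of sign. *)
- rewrite /ratio; field.
  rewrite dn0 -expr2 /=.
  by apply/and4P; split; [apply: lt0r_neq0 | apply: lt0r_neq0
    | apply: ltr0_neq0 | apply: ltr0_neq0]; lra.
- rewrite /ratio; field.
  by rewrite dn0 -expr2 /=; apply/andP; split; apply: lt0r_neq0; lra.
Qed.

(* [A #= `I_n] says that [A] is in bijection with [{0, .., n - 1}]. *)
Theorem proposition4p1 (R : realType) (c d m : R)
    (c_gt0 : 0 < c) (d_gt0 : 0 < d) (m_gt0 : 0 < m) :
  (d < 1 -> solutions c d m #= `I_1) /\
  (2 < d ->
    [/\ 0 < eta1 c d,
        eta1 c d < eta2 c d,
        eta1 c d < m -> m < eta2 c d -> solutions c d m #= `I_3 &
        m = eta1 c d \/ m = eta2 c d -> solutions c d m #= `I_2]).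
Proof.
split; first by move=> d1; exact: card_solutions_lt1.
move=> d2; have d1 : 1 < d by lra.
have [a [b [/andP[a0 a1] b1 ca cb [-> ->]]]] := eta_critical c d d2.
have b0 : 0 < b by exact: lt_trans b1.
have ab : a < b by exact: lt_trans b1.
have Fab := critical_ratio_lt d a b d2 a0 a1 b1 ca cb.
have D0 u : 0 < u -> 0 < u * (d + u) ^+ 3.
  by move=> u0; rewrite mulr_gt0 // exprn_gt0 // addr_gt0.
have M0 : 0 < m / c by exact: divr_gt0.
have cK u : c * u / c = u by rewrite mulrC mulKf // lt0r_neq0.
have root_ratio u : 0 < u -> root (quartic d (ratio d u)) u.
  by move=> u0; rewrite /root horner_quartic_ratio // subrr mulr0.
have qa_gt0 : ratio d a < m / c -> 0 < (quartic d (m / c)).[a].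
  by move=> Fa; rewrite horner_quartic_ratio // mulr_gt0 ?D0 // subr_gt0.
have qb_lt0 : m / c < ratio d b -> (quartic d (m / c)).[b] < 0.
  by move=> Fb; rewrite horner_quartic_ratio // pmulr_rlt0 ?D0 // subr_lt0.
split.
- by rewrite mulr_gt0 // ratio_gt0.
- by rewrite ltr_pM2l.
- move=> m1 m2; apply: (card_solutions_three c d m a b) => //.
    by apply: qa_gt0; rewrite ltr_pdivlMr // mulrC.
  by apply: qb_lt0; rewrite ltr_pdivrMr // mulrC.
- case=> mE.
  (* Double root at [a]; the other solution lies beyond [b], where [G] is negative. *)
  + have mc : m / c = ratio d a by rewrite mE cK.
    have [r br rr] : exists2 u, b < u & root (quartic d (m / c)) u.
      by apply: quartic_root_gt => //; apply: qb_lt0; rewrite mc.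
    have ar := lt_trans ab br.
    apply: (card_solutions_double c d m a r) => //.
    * exact: lt_trans ar.
    * by rewrite lt_eqF.
    * by rewrite mc; exact: root_ratio.
    * by rewrite mc; exact: critical_root_deriv.
  (* Double root at [b]; the other solution lies between 0 and [a], where [G] is positive at [a]. *)
  + have mc : m / c = ratio d b by rewrite mE cK.
    have [|r] := @poly_ivtoo _ (quartic d (m / c)) 0 a (ltW a0).
      by rewrite horner_quartic0 mulN1r oppr_lt0 qa_gt0 // mc.
    rewrite in_itv /= => /andP[r0 ra] rr.
    apply: (card_solutions_double c d m b r) => //.
    * by rewrite gt_eqF // (lt_trans ra).
    * by rewrite mc; exact: root_ratio.
    * by rewrite mc; exact: critical_root_deriv.
Qed.
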